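(* Let $0<p\le q$, and let $V_{p,q}$ be the unique (in law) strictly positive random variable, independent of $X_q$, such that $X_p\stackrel{d}{=}V_{p,q}X_q$. Then, for every bounded measurable $h:\mathbb{R}\to\mathbb{R}$, $$\mathbb{E}\,h(X_p)=\mathbb{E}\,h(V_{p,q}X_q).$$ If $p<q$, put $a=1/p$, $b=1/q$, let $S_{p/q}$ be positive $(p/q)$-stable and independent of $X_q$, and set $W_0=S_{p/q}^{-b}$. Then $$\mathbb{E}W_0=\frac{\Gamma(a)}{(p/q)\Gamma(b)}=\frac{a\,\Gamma(a)}{b\,\Gamma(b)}<\infty,$$ and, for every bounded measurable $h:\mathbb{R}\to\mathbb{R}$, $$\mathbb{E}\,h(X_p)=\frac{\mathbb{E}\left[W_0\,h\left(2^{a-b}W_0X_q\right)\right]}{\mathbb{E}W_0}.$$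
   Context: For $r>0$, $X_r\sim N_r(0,1)$ means that $X_r$ is a real random variable with density $$f_r(x)=\frac{r}{2^{1+1/r}\Gamma(1/r)}\exp\left(-\frac{|x|^r}{2}\right),\qquad x\in\mathbb{R}.$$ For $0<p\le q$, a strictly positive random variable $V_{p,q}$ independent of $X_q$ with $X_p\stackrel{d}{=}V_{p,q}X_q$ exists and its law is unique. The notation $\stackrel{d}{=}$ means equality in distribution. Positive $\alpha$-stable: for $0<\alpha<1$, $S_\alpha$ is the positive random variable with Laplace transform $\mathbb{E}e^{-uS_\alpha}=e^{-u^\alpha}$ for all $u\ge0$. *)

(* Defs.v *)
From HB Require Import structures.
From mathcomp Require Import all_boot all_order all_algebra.
From mathcomp Require Import all_classical all_reals all_analysis.

Set Implicit Arguments.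
Unset Strict Implicit.
Unset Printing Implicit Defensive.

Import Order.TTheory GRing.Theory Num.Theory.
Import numFieldNormedType.Exports.

Local Open Scope classical_set_scope.
Local Open Scope ring_scope.

(* Euler's integral; it is a genuine (finite) value only for x > 0. *)
Definition Gamma (R : realType) (x : R) : R :=
  \int[@lebesgue_measure R]_(t in `]0, +oo[) (t `^ (x - 1) * expR (- t)).

Definition gnormal_pdf (R : realType) (r x : R) : R :=
  r / (2 `^ (1 + r^-1) * Gamma r^-1) * expR (- (`|x| `^ r / 2)).

Definition has_density (d : measure_display) (T : measurableType d)
    (R : realType) (P : probability T R) (X : {RV P >-> R}) (f : R -> R) : Prop :=
  forall A : set R, measurable A ->
    distribution P X A = (\int[lebesgue_measure]_(x in A) (f x)%:E)%E.
Arguments has_density {d T R} P X f.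

(* X ~ N_r(0, 1), the generalized normal law. *)
Definition gnormal (d : measure_display) (T : measurableType d)
    (R : realType) (P : probability T R) (r : R) (X : {RV P >-> R}) : Prop :=
  has_density P X (gnormal_pdf r).
Arguments gnormal {d T R} P r X.

(* The two variables may live on different probability spaces. *)
Definition eq_in_law (d d' : measure_display) (T : measurableType d)
    (T' : measurableType d') (R : realType) (P : probability T R)
    (P' : probability T' R) (X : T -> R) (Y : T' -> R) : Prop :=
  forall A : set R, measurable A -> P (X @^-1` A) = P' (Y @^-1` A).
Arguments eq_in_law {d d' T T' R} P P' X Y.

Definition indep_RV (d : measure_display) (T : measurableType d)
    (R : realType) (P : probability T R) (X Y : {RV P >-> R}) : Prop :=
  forall A B : set R, measurable A -> measurable B ->
    P (X @^-1` A `&` Y @^-1` B) = (P (X @^-1` A) * P (Y @^-1` B))%E.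
Arguments indep_RV {d T R} P X Y.

Definition as_positive (d : measure_display) (T : measurableType d)
    (R : realType) (P : probability T R) (X : {RV P >-> R}) : Prop :=
  {ae P, forall t, 0 < X t}.
Arguments as_positive {d T R} P X.

(* Meaningful for 0 < alpha < 1. *)
Definition positive_stable (d : measure_display) (T : measurableType d)
    (R : realType) (P : probability T R) (alpha : R) (S : {RV P >-> R}) : Prop :=
  as_positive P S /\
  forall u : R, 0 <= u ->
    ('E_P[fun t => expR (- (u * S t))] = (expR (- (u `^ alpha)))%:E)%E.
Arguments positive_stable {d T R} P alpha S.

Definition bounded_measurable (R : realType) (h : R -> R) : Prop :=
  measurable_fun [set: R] h /\ [bounded h x | x in [set: R]].

(* Main.v *)
Require Import Defs.
From HB Require Import structures.
From mathcomp Require Import all_boot all_order all_algebra.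
From mathcomp Require Import all_classical all_reals all_analysis.
From mathcomp Require Import measurable_realfun ring.

(** Conditionally on [S = s], the variable [c s^(-b) X_q] has a density whose
    value at [y], multiplied by the weight [s^(-b)], is a constant times
    [exp (- s |y|^q / (2 c^q))]: the Jacobian of the scaling cancels the weight.
    Averaging over [S] evaluates its Laplace transform at [|y|^q / (2 c^q)], and
    for [c = 2^(a-b)] the result is [exp (- |y|^p / 2)]. Hence
    [E (W_0 g (c W_0 X_q)) = K E (g (X_p))] for every measurable [g >= 0], where [K]
    is a ratio of normalizing constants; [g = 1] shows that [K = E W_0]. *)

Set Implicit Arguments.
Unset Strict Implicit.
Unset Printing Implicit Defensive.

Import Order.TTheory GRing.Theory Num.Theory.
Import numFieldNormedType.Exports.

Local Open Scope classical_set_scope.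
Local Open Scope ring_scope.

(** * Scaling of Lebesgue measure on the line *)

(** By uniqueness of Lebesgue measure it suffices to compare on half-open intervals: the preimage of
    []a, b]] is []a / k, b / k]], whose length the factor [k] restores. *)
Lemma lebesgue_measureZ (R : realType) (k : R) (A : set R) : 0 < k ->
  measurable A ->
  (k%:E * pushforward lebesgue_measure ( *%R k : _ -> measurableTypeR R) A
    = lebesgue_measure A)%E.
Proof.
move=> k0 mA.
have mk : measurable_fun [set: measurableTypeR R]
    ( *%R k : _ -> measurableTypeR R) by exact: measurable_funM.
pose m := mscale (NngNum (ltW k0))
  (pushforward (@lebesgue_measure R) ( *%R k : _ -> measurableTypeR R)).
suff -> : lebesgue_measure A = m mk A by [].
apply: lebesgue_measure_unique => // _ [[a b]] _ <-.
transitivity (k%:E * lebesgue_measure `](k^-1 * a)%R, (k^-1 * b)%R]%classic)%E; last first.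
  rewrite /m /mscale /= /pushforward; congr (_ * lebesgue_measure _)%E.
  by apply/seteqP; split=> x /=; rewrite !in_itv/= ler_pdivlMl// ltr_pdivrMl.
rewrite !lebesgue_measure_itv/= !lte_fin ltr_pM2l ?invr_gt0//.
case: ifPn => _; last by rewrite mule0.
by rewrite -EFinB -EFinM -mulrBr mulVKf// gt_eqF.
Qed.

Lemma ge0_integralZ_arg (R : realType) (k : R) (g : R -> \bar R) : 0 < k ->
  measurable_fun [set: R] g -> (forall x, 0 <= g x)%E ->
  (k%:E * \int[lebesgue_measure]_x g (k * x)%R = \int[lebesgue_measure]_x g x)%E.
Proof.
move=> k0 mg g0.
have mk : measurable_fun [set: measurableTypeR R]
    ( *%R k : _ -> measurableTypeR R) by exact: measurable_funM.
pose m := mscale (NngNum (ltW k0))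
  (pushforward (@lebesgue_measure R) ( *%R k : _ -> measurableTypeR R)).
rewrite [RHS](eq_measure_integral (m mk)); last first.
  by move=> A mA _; exact/esym/lebesgue_measureZ.
rewrite ge0_integral_mscale//= ge0_integral_pushforward//.
Qed.

(** * Integrals of functions of a variable with a density and of an independent pair *)

(** The density forces the law to be absolutely continuous. Its Radon-Nikodym derivative has the
    same integral as [f] over every measurable set, hence equals [f] almost everywhere and can be
    replaced by it. *)
Lemma ge0_integral_density (d : measure_display) (T : measurableType d)
    (R : realType) (P : probability T R) (X : {RV P >-> R}) (f : R -> R)
    (g : R -> \bar R) :
  measurable_fun [set: R] f -> has_density P X f ->
  measurable_fun [set: R] g -> (forall x, 0 <= g x)%E ->
  (\int[P]_t g (X t) = \int[lebesgue_measure]_x (g x * (f x)%:E))%E.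
Proof.
move=> mf Xf mg g0.
(* [lebesgue_measure] lives on [measurableTypeR R], whose display differs from
   that of [R], so [X] is repackaged before Radon-Nikodym can be applied. *)
have mX : measurable_fun [set: T] (X : T -> measurableTypeR R).
  exact: (measurable_funP X).
pose Y : {mfun T >-> measurableTypeR R} :=
  HB.pack (X : T -> measurableTypeR R) (isMeasurableFun.Build _ _ _ _ _ mX).
pose mu := @lebesgue_measure R.
pose nu : probability (measurableTypeR R) R := distribution P Y.
have nuE A : measurable A -> nu A = (\int[mu]_(x in A) (f x)%:E)%E.
  by move=> mA; exact: Xf.
have mF : measurable_fun [set: R] (EFin \o f) by exact/measurable_EFinP.
have dom : nu `<< mu.
  apply/null_content_dominatesP => A mA A0; rewrite nuE//.
  by apply: null_set_integral => //; exact: measurable_funTS.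
transitivity (\int[nu]_x g x)%E; first by rewrite ge0_integral_distribution.
rewrite -(Radon_Nikodym_SigmaFinite.change_of_variables dom)//.
apply: ae_eq_integral => //.
- apply: emeasurable_funM => //.
  exact: measurable_int (Radon_Nikodym_SigmaFinite.f_integrable dom).
- exact: emeasurable_funM.
- apply: ae_eqe_mul2l; apply: integral_ae_eq => //.
    exact: Radon_Nikodym_SigmaFinite.f_integrable.
  move=> E _ mE; rewrite -Radon_Nikodym_SigmaFinite.f_integral//; exact: nuE.
Qed.

(** Independence says that the joint law agrees with the product of the marginals on rectangles,
    hence everywhere; Tonelli then splits the integral. *)
Lemma ge0_integral_indep (d : measure_display) (T : measurableType d)
    (R : realType) (P : probability T R) (X Y : {RV P >-> R})
    (G : R * R -> \bar R) : indep_RV P X Y ->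
  measurable_fun [set: R * R] G -> (forall z, 0 <= G z)%E ->
  (\int[P]_t G (X t, Y t) =
   \int[P]_s \int[P]_t G (X s, Y t))%E.
Proof.
move=> XY mG G0.
have mXY : measurable_fun [set: T] (fun t => (X t, Y t)).
  by apply: measurable_fun_pair.
pose phi : {mfun T >-> (R * R)%type} :=
  HB.pack (fun t => (X t, Y t)) (isMeasurableFun.Build _ _ _ _ _ mXY).
transitivity (\int[distribution P phi]_z G z)%E.
  by rewrite ge0_integral_distribution.
rewrite (@eq_measure_integral _ _ _ _ (distribution P X \x distribution P Y)%E).
  rewrite fubini_tonelli1// ge0_integral_distribution//=; first last.
  - by move=> x; exact: integral_ge0.
  - exact: measurable_fun_fubini_tonelli_F.
  apply: eq_integral => s _; rewrite /fubini_F ge0_integral_distribution//.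
  exact: measurable_fun_pair2.
by move=> A mA _; apply/esym; exact: product_measure_unique.
Qed.

(** * The generalized normal density and its constants *)

Definition gnormal_cst (R : realType) (r : R) : R :=
  r / (2 `^ (1 + r^-1) * Gamma r^-1).

Lemma Gamma_ge0 (R : realType) (x : R) : 0 <= Gamma x.
Proof. by apply: Rintegral_ge0 => t _; rewrite mulr_ge0 ?powR_ge0 ?expR_ge0. Qed.

Lemma gnormal_cst_ge0 (R : realType) (r : R) : 0 < r -> 0 <= gnormal_cst r.
Proof.
by move=> r0; rewrite divr_ge0 ?(ltW r0)// mulr_ge0 ?powR_ge0 ?Gamma_ge0.
Qed.

Lemma gnormal_pdf_ge0 (R : realType) (r x : R) : 0 < r -> 0 <= gnormal_pdf r x.
Proof. by move=> r0; rewrite mulr_ge0 ?expR_ge0// gnormal_cst_ge0. Qed.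

Lemma measurable_gnormal_pdf (R : realType) (r : R) :
  measurable_fun [set: R] (gnormal_pdf r).
Proof.
apply: measurable_funM => //; apply: measurableT_comp => //.
apply: measurableT_comp => //; apply: measurable_funM => //.
by apply: (measurableT_comp (measurable_powR r)); exact: normr_measurable.
Qed.

(* If the integral were [0], division by zero would make the density identically
   [0], contradicting total mass [1]; so Euler's integral need not be studied. *)
Lemma gnormal_Gamma_neq0 (d : measure_display) (T : measurableType d)
    (R : realType) (P : probability T R) (r : R) (X : {RV P >-> R}) :
  gnormal P r X -> Gamma r^-1 != 0.
Proof.
move=> /(_ _ measurableT) XT; apply/eqP => G0.
move: XT; rewrite probability_setT integral0_eq => [/eqP|x _].
  by rewrite onee_eq0.
by rewrite /gnormal_pdf G0 mulr0 invr0 mulr0 mul0r.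
Qed.

(** With [w = s^(-1/q)], the Jacobian [1/(c w)] times the weight [w] leaves [1/c], and [w^(-q) = s]
    makes the exponent linear in [s], the form a Laplace transform requires. *)
Lemma gnormal_pdf_scale (R : realType) (q c s y : R) :
  0 < q -> 0 < c -> 0 < s ->
  (c * s `^ (- q^-1))^-1 *
    (s `^ (- q^-1) * gnormal_pdf q ((c * s `^ (- q^-1))^-1 * y)) =
  gnormal_cst q / c * expR (- (`|y| `^ q * c `^ (- q) / 2 * s)).
Proof.
move=> q0 c0 s0; have w0 : 0 < s `^ (- q^-1) by exact: powR_gt0.
set w := s `^ (- q^-1) in w0 *.
have kq : (c * w)^-1 `^ q = c `^ (- q) * s.
  have cw0 : 0 <= c * w by rewrite mulr_ge0 ?ltW.
  rewrite -powR_inv1// -powRrM mulN1r powRM ?ltW//; congr (_ * _).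
  by rewrite /w -powRrM mulrNN mulVf ?gt_eqF// powRr1// ltW.
rewrite /gnormal_pdf -/(gnormal_cst q) normrM gtr0_norm ?invr_gt0 ?mulr_gt0//.
rewrite powRM ?invr_ge0 ?mulr_ge0 ?(ltW c0) ?(ltW w0)// kq.
have -> : c `^ (- q) * s * `|y| `^ q / 2 = `|y| `^ q * c `^ (- q) / 2 * s by ring.
by field; rewrite !gt_eqF.
Qed.

(** This is what fixes [c = 2^(1/p - 1/q)]: then [c^(-q) / 2 = 2^(-q/p)], and the power [p/q] turns
    this into [1/2]. *)
Lemma gnormal_stable_exponent (R : realType) (p q y : R) : 0 < p -> 0 < q ->
  (`|y| `^ q * (2 `^ (p^-1 - q^-1)) `^ (- q) / 2) `^ (p / q) = `|y| `^ p / 2.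
Proof.
move=> p0 q0; have [p0' q0'] := (lt0r_neq0 p0, lt0r_neq0 q0).
rewrite -[X in _ / X]powRr1// -powRN -mulrA -powRrM -powRD ?pnatr_eq0 ?implybT//.
rewrite powRM ?powR_ge0// -!powRrM; congr (_ * _).
  by congr (_ `^ _); field.
rewrite -[RHS]powR_inv1//; congr (_ `^ _); field.
by rewrite p0' q0'.
Qed.

(** Identifies the ratio of normalizing constants: the powers of 2 cancel because the exponent
    [1 + 1/p] splits as [(1 + 1/q) + (1/p - 1/q)]. *)
Lemma gnormal_cst_ratio (R : realType) (p q : R) :
  0 < p -> 0 < q -> Gamma p^-1 != 0 -> Gamma q^-1 != 0 ->
  gnormal_cst q / 2 `^ (p^-1 - q^-1) =
  Gamma p^-1 / ((p / q) * Gamma q^-1) * gnormal_cst p.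
Proof.
move=> p0 q0 Gp Gq; rewrite /gnormal_cst.
have -> : 1 + p^-1 = (1 + q^-1) + (p^-1 - q^-1) :> R by ring.
rewrite (@powRD _ 2 (1 + q^-1) (p^-1 - q^-1)) ?pnatr_eq0 ?implybT//.
have t1 : 2 `^ (1 + q^-1) != 0 :> R by rewrite gt_eqF// powR_gt0.
have t2 : 2 `^ (p^-1 - q^-1) != 0 :> R by rewrite gt_eqF// powR_gt0.
by field; rewrite t1 t2 Gp Gq !gt_eqF.
Qed.

(** * The weighted stable mixture of scaled generalized normal laws *)

Lemma ge0_integral_gnormal_scale (d : measure_display) (T : measurableType d)
    (R : realType) (P : probability T R) (X : {RV P >-> R}) (q c s : R)
    (g : R -> \bar R) :
  0 < q -> 0 < c -> 0 < s -> gnormal P q X ->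
  measurable_fun [set: R] g -> (forall x, 0 <= g x)%E ->
  (\int[P]_t ((s `^ (- q^-1))%:E * g (c * s `^ (- q^-1) * X t)%R) =
   \int[lebesgue_measure]_y (g y *
     (gnormal_cst q / c * expR (- (`|y| `^ q * c `^ (- q) / 2 * s)))%:E))%E.
Proof.
move=> q0 c0 s0 Xq mg g0; set w := s `^ (- q^-1).
have w0 : 0 < w by exact: powR_gt0.
have k0 : 0 < c * w by exact: mulr_gt0.
pose k := c * w.
have mgk : measurable_fun [set: R] (fun x => w%:E * g (k * x)%R)%E.
  apply: emeasurable_funM => //; apply: (measurableT_comp mg).
  exact: measurable_funM.
(* [psi] is the integrand in the new variable [y = k x], Jacobian included, so that
   [k * psi (k * x)] is the integrand in [x]. *)
pose psi y := (k^-1%:E * (g y * (w * gnormal_pdf q (k^-1 * y))%R%:E))%E.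
have psi0 y : (0 <= psi y)%E.
  rewrite mule_ge0 ?lee_fin ?invr_ge0 ?(ltW k0)// mule_ge0// lee_fin.
  by rewrite mulr_ge0 ?gnormal_pdf_ge0// ltW.
have mpsi : measurable_fun [set: R] psi.
  apply: emeasurable_funM => //; apply: emeasurable_funM => //.
  apply/measurable_EFinP; apply: measurable_funM => //.
  by apply: (measurableT_comp (measurable_gnormal_pdf q)); exact: measurable_funM.
have mpsik : measurable_fun [set: R] (fun x => psi (k * x)).
  by apply: (measurableT_comp mpsi); exact: measurable_funM.
transitivity (\int[lebesgue_measure]_x (w%:E * g (k * x)%R * (gnormal_pdf q x)%:E))%E.
  apply: (ge0_integral_density (measurable_gnormal_pdf q) Xq mgk) => x.
  by rewrite mule_ge0// lee_fin ltW.
transitivity (\int[lebesgue_measure]_x (k%:E * psi (k * x)%R))%E.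
  apply: eq_integral => x _; rewrite /psi muleA -EFinM mulfV ?gt_eqF//.
  rewrite mul1e mulKf ?gt_eqF// [in RHS]EFinM [RHS]muleA.
  by congr (_ * _)%E; rewrite muleC.
transitivity (k%:E * \int[lebesgue_measure]_x psi (k * x)%R)%E.
  by apply: ge0_integralZl => //; rewrite lee_fin ltW.
rewrite (ge0_integralZ_arg k0 mpsi psi0).
by apply: eq_integral => y _; rewrite /psi muleCA -EFinM gnormal_pdf_scale.
Qed.

(** Taking [g >= 0] extended-valued lets Tonelli apply without integrability; [g = 1] and the two
    parts of [h] are the instances used later. *)
Lemma ge0_integral_stable_mixture (R : realType) (p q : R) (d0 : measure_display)
    (T0 : measurableType d0) (P0 : probability T0 R) (Xp : {RV P0 >-> R})
    (d : measure_display) (T : measurableType d) (P : probability T R)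
    (S Xq : {RV P >-> R}) (g : R -> \bar R) :
  0 < p -> 0 < q -> gnormal P0 p Xp ->
  positive_stable P (p / q) S -> gnormal P q Xq -> indep_RV P S Xq ->
  measurable_fun [set: R] g -> (forall x, 0 <= g x)%E ->
  (\int[P]_t ((S t `^ (- q^-1))%:E *
      g (2 `^ (p^-1 - q^-1) * S t `^ (- q^-1) * Xq t)%R) =
   (Gamma p^-1 / ((p / q) * Gamma q^-1))%:E * \int[P0]_t g (Xp t))%E.
Proof.
move=> p0 q0 Xp_p [S0 SL] Xq_q SX mg g0.
set c := 2 `^ (p^-1 - q^-1); have c0 : 0 < c by exact: powR_gt0.
pose w (s : R) := s `^ (- q^-1).
have mw : measurable_fun [set: R] w by exact: measurable_powR.
pose G (z : R * R) := ((w z.1)%:E * g (c * w z.1 * z.2)%R)%E.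
have G0 z : (0 <= G z)%E by rewrite mule_ge0// lee_fin powR_ge0.
have mG : measurable_fun [set: R * R] G.
  have mw1 : measurable_fun [set: R * R] (fun z => w z.1).
    exact: (measurableT_comp mw).
  apply: emeasurable_funM; first exact/measurable_EFinP.
  apply: (measurableT_comp mg); apply: measurable_funM => //.
  exact: measurable_funM.
pose u (y : R) := `|y| `^ q * c `^ (- q) / 2.
have u0 y : 0 <= u y by rewrite divr_ge0// mulr_ge0 ?powR_ge0.
have mu_ : measurable_fun [set: R] u.
  apply: measurable_funM => //; apply: measurable_funM => //.
  by apply: (measurableT_comp (measurable_powR q)); exact: normr_measurable.
pose k := gnormal_cst q / c.
have k0 : 0 <= k by rewrite divr_ge0 ?gnormal_cst_ge0// ltW.
pose K (z : T * measurableTypeR R) :=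
  (g z.2 * (k * expR (- (u z.2 * S z.1)))%:E)%E.
have K0 z : (0 <= K z)%E by rewrite mule_ge0// lee_fin mulr_ge0 ?expR_ge0.
have mK : measurable_fun [set: T * measurableTypeR R] K.
  apply: emeasurable_funM.
    by apply: (measurableT_comp (mg : measurable_fun [set: measurableTypeR R] g)).
  apply/measurable_EFinP; apply: measurable_funM => //.
  apply: measurableT_comp => //; apply: measurableT_comp => //.
  apply: measurable_funM.
    by apply: (measurableT_comp (mu_ : measurable_fun [set: measurableTypeR R] u)).
  exact: measurableT_comp.
rewrite (ge0_integral_indep SX mG G0).
have mG' : measurable_fun [set: T * T] (fun z => G (S z.1, Xq z.2)).
  apply: (measurableT_comp mG); apply: measurable_fun_pair;
  exact: measurableT_comp.
transitivity (\int[P]_t \int[lebesgue_measure]_y K (t, y))%E.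
  (* The scaling identity requires [s > 0], which [S] satisfies only almost surely. *)
  apply: ge0_ae_eq_integral => //.
  - exact: (measurable_fun_fubini_tonelli_F _ mG').
  - exact: measurable_fun_fubini_tonelli_F.
  - by move=> t _; exact: integral_ge0.
  - by move=> t _; exact: integral_ge0.
  apply: filterS S0 => t St _.
  exact: ge0_integral_gnormal_scale.
(* After the exchange, the inner integral for fixed [y] is a constant times the Laplace transform of
   [S] at [u y]. *)
rewrite (fubini_tonelli _ mK K0).
transitivity (\int[lebesgue_measure]_y ((Gamma p^-1 / (p / q * Gamma q^-1))%:E *
   (g y * (gnormal_pdf p y)%:E)))%E; last first.
  rewrite ge0_integralZl//; first last.
  - rewrite lee_fin divr_ge0 ?Gamma_ge0// mulr_ge0 ?Gamma_ge0//.
    by rewrite divr_ge0 ?(ltW p0) ?(ltW q0).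
  - by move=> y _; rewrite mule_ge0// lee_fin gnormal_pdf_ge0.
  - apply: emeasurable_funM => //; apply/measurable_EFinP.
    exact: measurable_gnormal_pdf.
  congr (_ * _)%E.
  exact/esym/(ge0_integral_density (measurable_gnormal_pdf p) Xp_p mg g0).
apply: eq_integral => y _; rewrite /K/=.
under eq_integral do rewrite EFinM muleA.
rewrite ge0_integralZl//; first last.
- by rewrite mule_ge0.
- apply/measurable_EFinP; apply: measurableT_comp => //.
  by apply: measurableT_comp => //; exact: measurable_funM.
have := SL _ (u0 y); rewrite unlock => ->.
have pdfE : gnormal_pdf p y = gnormal_cst p * expR (- (`|y| `^ p / 2)) by [].
rewrite gnormal_stable_exponent// -muleA [RHS]muleCA -!EFinM pdfE mulrA.
have [Gp Gq] := (gnormal_Gamma_neq0 Xp_p, gnormal_Gamma_neq0 Xq_q).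
by rewrite -(gnormal_cst_ratio p0 q0 Gp Gq).
Qed.

(** * Transfer along equality in law, and the two representations of the law of [Xp] *)

Lemma eq_in_law_ge0_integral (d d' : measure_display) (T : measurableType d)
    (T' : measurableType d') (R : realType) (P : probability T R)
    (P' : probability T' R) (X : T -> R) (Y : T' -> R) (g : R -> \bar R) :
  measurable_fun [set: T] X -> measurable_fun [set: T'] Y ->
  eq_in_law P P' X Y ->
  measurable_fun [set: R] g -> (forall x, 0 <= g x)%E ->
  (\int[P]_t g (X t) = \int[P']_t g (Y t))%E.
Proof.
move=> mX mY XY mg g0.
transitivity (\int[pushforward P X]_x g x)%E.
  by rewrite ge0_integral_pushforward.
rewrite (eq_measure_integral (pushforward P' Y)); last by move=> A mA _; exact: XY.
by rewrite ge0_integral_pushforward.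
Qed.

(** Positive and negative parts are matched separately, so the two differences agree even when an
    integral is infinite. *)
Lemma eq_in_law_expectation (d d' : measure_display) (T : measurableType d)
    (T' : measurableType d') (R : realType) (P : probability T R)
    (P' : probability T' R) (X : T -> R) (Y : T' -> R) (h : R -> R) :
  measurable_fun [set: T] X -> measurable_fun [set: T'] Y ->
  eq_in_law P P' X Y -> measurable_fun [set: R] h ->
  ('E_P[fun t => h (X t)] = 'E_P'[fun t => h (Y t)])%E.
Proof.
move=> mX mY XY /measurable_EFinP mh; rewrite unlock integralE [RHS]integralE.
have mhp := measurable_funepos mh; have mhn := measurable_funeneg mh.
congr (_ - _)%E.
- rewrite (funepos_comp (EFin \o h) X) (funepos_comp (EFin \o h) Y).
  exact: (eq_in_law_ge0_integral mX mY XY mhp (funepos_ge0 _)).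
- rewrite (funeneg_comp (EFin \o h) X) (funeneg_comp (EFin \o h) Y).
  exact: (eq_in_law_ge0_integral mX mY XY mhn (funeneg_ge0 _)).
Qed.

Theorem corollary4 (R : realType) (p q : R) (hp : 0 < p) (hpq : p <= q)
    (d0 : measure_display) (T0 : measurableType d0) (P0 : probability T0 R)
    (Xp : {RV P0 >-> R}) (hXp : gnormal P0 p Xp) :
  (forall (d : measure_display) (T : measurableType d) (P : probability T R)
      (V Xq : {RV P >-> R}),
    gnormal P q Xq -> as_positive P V -> indep_RV P V Xq ->
    eq_in_law P0 P Xp (fun t => V t * Xq t) ->
    forall h : R -> R, bounded_measurable h ->
      ('E_P0[fun t => h (Xp t)] = 'E_P[fun t => (h (V t * Xq t))%R])%E)
  /\
  (p < q ->
    forall (d : measure_display) (T : measurableType d) (P : probability T R)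
      (S Xq : {RV P >-> R}),
    positive_stable P (p / q) S -> gnormal P q Xq -> indep_RV P S Xq ->
    let a := p^-1 in
    let b := q^-1 in
    let W0 := fun t : T => S t `^ (- b) in
    [/\ ('E_P[W0] = (Gamma a / ((p / q) * Gamma b))%:E)%E,
        Gamma a / ((p / q) * Gamma b) = (a * Gamma a) / (b * Gamma b),
        ('E_P[W0] < +oo)%E &
        forall h : R -> R, bounded_measurable h ->
          ('E_P0[fun t => h (Xp t)] =
             'E_P[fun t => (W0 t * h (2 `^ (a - b) * W0 t * Xq t))%R]
             / 'E_P[W0])%E]).
Proof.
have q0 : 0 < q := lt_le_trans hp hpq; split.
  move=> d T P V Xq _ _ _ XpVXq h [mh _].
  apply: eq_in_law_expectation => //; exact: measurable_funM.
move=> pq d T P S Xq Sst hXq SX a b W0.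
have Gp : Gamma a != 0 by exact: gnormal_Gamma_neq0 hXp.
have Gq : Gamma b != 0 by exact: gnormal_Gamma_neq0 hXq.
pose K := Gamma a / (p / q * Gamma b).
have mixture g : measurable_fun [set: R] g -> (forall x, 0 <= g x)%E ->
    (\int[P]_t ((W0 t)%:E * g (2 `^ (a - b) * W0 t * Xq t)%R) =
     K%:E * \int[P0]_t g (Xp t))%E.
  by move=> mg g0; exact: ge0_integral_stable_mixture.
have EW0 : ('E_P[W0] = K%:E)%E.
  have := mixture (cst 1%E) (measurable_cst _) (fun=> lee01).
  have -> : (\int[P0]_t cst 1%E (Xp t) = 1)%E.
    by have := expectation_cst P0 1; rewrite unlock.
  rewrite mule1 => <-.
  by rewrite unlock; apply: eq_integral => t _; rewrite mule1.
(* Division by the mean of [W0] is inversion in the extended reals, which is genuine only away from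
   0. *)
have K0 : K != 0.
  by rewrite !mulf_neq0 ?invr_neq0 ?mulf_neq0 ?invr_neq0// gt_eqF.
split => //.
- by rewrite /a /b; field; rewrite Gq !gt_eqF.
- by rewrite EW0 ltry.
move=> h [mh hbnd].
have mH : measurable_fun [set: R] (EFin \o h) by exact/measurable_EFinP.
(* Integrability rules out an [oo - oo] when [K] is distributed over the positive and negative
   parts. *)
have inth : P0.-integrable [set: T0] (fun t => (h (Xp t))%:E).
  apply: measurable_bounded_integrable => //.
  - by rewrite ltey_eq fin_num_measure.
  - exact: measurableT_comp.
  - case: hbnd => M [Mreal hM]; exists M; split=> // x Mx t _; exact: hM.
suff -> : ('E_P[fun t => (W0 t * h (2 `^ (a - b) * W0 t * Xq t))%R] =
    K%:E * 'E_P0[fun t => h (Xp t)])%E.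
  by rewrite EW0 inver (negbTE K0) muleC muleA -EFinM mulVf// mul1e.
rewrite unlock integralE [in RHS]integralE muleBr//; last first.
  exact: integrable_add_def.
(* Since [W0 >= 0], the positive and negative parts of [W0 * h] are [W0] times those of [h], so
   [mixture] applies to each. *)
have W00 t : (0 <= (W0 t)%:E)%E by rewrite lee_fin powR_ge0.
have mHp := measurable_funepos mH; have mHn := measurable_funeneg mH.
congr (_ - _)%E.
- rewrite (funepos_comp (EFin \o h) Xp) -[RHS](mixture _ mHp (funepos_ge0 _)).
  by apply: eq_integral => t _; rewrite !funeposE maxe_pMr// mule0.
- rewrite (funeneg_comp (EFin \o h) Xp) -[RHS](mixture _ mHn (funeneg_ge0 _)).
  by apply: eq_integral => t _; rewrite !funenegE maxe_pMr// mule0 muleN.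
Qed.
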